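(* Let $G$ be a connected graph with $n$ vertices and price function $P$, and label the vertices so that their prices satisfy $p^{1}\le p^{2}\le\cdots\le p^{n}$. Then for every integer $t$ with $1\le t<n$, \[ \sum_{i=t+1}^{n}(p^{i}-1)+p^{n}(t-1)+1\le \pi_{P}^{t}(G). \]
   Context: A configuration of $k$ pebbles on a graph $G$ is a function $C:V(G)\to\mathbb{Z}_{\ge 0}$ with $\sum_{v}C(v)=k$. A price function is a function $P:V(G)\to\mathbb{Z}_{\ge 2}$. A pebbling move along an edge $v_hv_k$ removes $P(v_h)$ pebbles from $v_h$ and adds one pebble to $v_k$; it is allowed only if the result has no negative values. A configuration $C'$ is derivable from $C$ if it is obtained from $C$ by a finite sequence of pebbling moves. A configuration covers a set of vertices if it is nonzero at each of them. A configuration $C$ is $t$-solvable if for every set of $t$ vertices there is a configuration derivable from $C$ covering that set. For $1\le t\le n$, $\pi_P^t(G)$ is the minimum $k$ such that every configuration of $k$ pebbles on $G$ (with price function $P$) is $t$-solvable. *)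

(* Defs.v *)
(* MathComp; [boolp] supplies the classical decision of [all_solvable] needed
   by [ex_minn], and choice in the existence proof. *)
From HB Require Import structures.
From Stdlib Require Import Relation_Operators.
From mathcomp Require Import all_boot.
From mathcomp Require Import boolp.

Set Implicit Arguments.
Unset Strict Implicit.
Unset Printing Implicit Defensive.

Record sgraph := SGraph {
  vertex :> finType;
  edge : rel vertex;
  edge_sym : symmetric edge;
  edge_irrefl : irreflexive edge }.

Definition connected_graph (G : sgraph) : Prop :=
  forall x y : G, connect (@edge G) x y.

Record price_function (G : sgraph) := PriceFunction {
  price :> G -> nat;
  price_ge2 : forall v, 2 <= price v }.

Definition config (G : sgraph) := {ffun G -> nat}.

Definition num_pebbles (G : sgraph) (C : config G) : nat := \sum_(v : G) C v.

(* The guard [P x <= C x] makes the truncated subtraction exact; it is the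
   nonnegativity of the result, as [x != y] by irreflexivity. *)
Definition pebbling_move (G : sgraph) (P : price_function G)
    (C C' : config G) : Prop :=
  exists x y : G, [/\ edge x y, P x <= C x &
    C' = [ffun v => C v - (if v == x then P x else 0)
                    + (if v == y then 1 else 0)]].

Definition derivable (G : sgraph) (P : price_function G)
    (C C' : config G) : Prop :=
  clos_refl_trans _ (pebbling_move P) C C'.

Definition covers (G : sgraph) (C : config G) (S : {set G}) : Prop :=
  forall v, v \in S -> C v != 0.

Definition solvable (G : sgraph) (P : price_function G) (t : nat)
    (C : config G) : Prop :=
  forall S : {set G}, #|S| = t -> exists2 C', derivable P C C' & covers C' S.

Definition all_solvable (G : sgraph) (P : price_function G) (t k : nat) : Prop :=
  forall C : config G, num_pebbles C = k -> solvable P t C.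

Section Existence.
Variables (G : sgraph) (P : price_function G).

Let cadd (C D : config G) : config G := [ffun v => C v + D v].
Let cat_ (u : G) (m : nat) : config G := [ffun v => if v == u then m else 0].

Let derivable_add E C D : derivable P C D -> derivable P (cadd C E) (cadd D E).
Proof.
elim=> [{}C {}D [x [y [exy le_P ->]]]|{}C|C1 C2 C3 _ h1 _ h2].
- apply: rt_step; exists x, y.
  split=> //; first by rewrite ffunE (leq_trans le_P) ?leq_addr.
  apply/ffunP=> v; rewrite !ffunE.
  by case: (v =P x) => [->|_]; rewrite ?subn0 addnAC // addnBAC.
- exact: rt_refl.
- exact: rt_trans h1 h2.
Qed.

Let derivable_add2 C D C' D' : derivable P C D -> derivable P C' D' ->
  derivable P (cadd C C') (cadd D D').
Proof.
have caddC A B : cadd A B = cadd B A.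
  by apply/ffunP=> v; rewrite !ffunE addnC.
move=> h h'; apply: rt_trans (derivable_add C' h) _.
by rewrite ![cadd D _]caddC; apply: derivable_add.
Qed.

Let derivable_scale u w a : derivable P (cat_ u a) (cat_ w 1) ->
  forall m, derivable P (cat_ u (a * m)) (cat_ w m).
Proof.
have catD x i j : cat_ x (i + j) = cadd (cat_ x i) (cat_ x j).
  by apply/ffunP=> v; rewrite !ffunE; case: eqP.
have cat0 x y : cat_ x 0 = cat_ y 0.
  by apply/ffunP=> v; rewrite !ffunE; do 2 case: eqP.
move=> h; elim=> [|m IHm]; first by rewrite muln0 (cat0 u w); apply: rt_refl.
by rewrite mulnS -add1n !catD; apply: derivable_add2.
Qed.

Let derivable_path u p : path (@edge G) u p ->
  exists a, derivable P (cat_ u a) (cat_ (last u p) 1).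
Proof.
elim: p u => [|w p IHp] u /= => [_|/andP[euw /IHp[a ha]]].
  by exists 1; apply: rt_refl.
exists (P u * a); apply: rt_trans (derivable_scale _ _) ha.
apply: rt_step; exists u, w; split=> //; first by rewrite ffunE eqxx.
by apply/ffunP=> v; rewrite !ffunE; case: eqP => //= _; rewrite subnn.
Qed.

Lemma all_solvable_exists (t : nat) :
  connected_graph G -> exists k, all_solvable P t k.
Proof.
move=> conG.
have hub u : exists a, derivable P (cat_ u a) [ffun=> 1].
  suff /(_ (enum G) (enum_uniq _)) [a ha]: forall s : seq G, uniq s ->
      exists a, derivable P (cat_ u a) [ffun v => nat_of_bool (v \in s)].
    exists a; congr (derivable _ _ _): ha.
    by apply/ffunP=> v; rewrite !ffunE mem_enum.
  elim=> [_|w s IHs /= /andP[ws /IHs[a ha]]].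
    exists 0; congr (derivable _ _ _): (rt_refl _ (pebbling_move P) (cat_ u 0)).
    by apply/ffunP=> v; rewrite !ffunE; case: eqP.
  have /connectP[p /derivable_path[b hb] ew] := conG u w.
  exists (b + a); congr (derivable _ _ _): (derivable_add2 hb ha).
    by apply/ffunP=> v; rewrite !ffunE; case: eqP.
  apply/ffunP=> v; rewrite !ffunE -ew inE.
  by case: (v =P w) => [->|//]; rewrite (negbTE ws).
have [N hN] := choice hub.
exists (\sum_u N u).+1 => C sizeC S _.
have [u le_u] : exists u, N u <= C u.
  apply: contrapT => no_u.
  suff: num_pebbles C <= \sum_u N u by rewrite sizeC ltnn.
  apply: leq_sum => u _; apply: ltnW; rewrite ltnNge.
  by apply/negP=> le_u; apply: no_u; exists u.
pose E : config G := [ffun v => C v - (if v == u then N u else 0)].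
exists (cadd [ffun=> 1] E); last by move=> v _; rewrite !ffunE.
congr (derivable _ _ _): (derivable_add E (hN u)).
apply/ffunP=> v; rewrite !ffunE.
by case: (v =P u) => [->|_]; rewrite ?subn0 // subnKC.
Qed.

Lemma all_solvable_existsb (t : nat) :
  connected_graph G -> exists k, `[< all_solvable P t k >].
Proof.
by move=> /(all_solvable_exists t)[k hk]; exists k; apply/asboolP.
Qed.

End Existence.

(* The least [k] such that every configuration of [k] pebbles is t-solvable;
   connectedness guarantees that such a [k] exists. Meaningful for
   [1 <= t <= #|G|]. *)
Definition pebbling_number (G : sgraph) (conG : connected_graph G)
    (P : price_function G) (t : nat) : nat :=
  ex_minn (all_solvable_existsb P t conG).

(* Main.v *)
(* Let S consist of the t vertices labelled 1, ..., t.  Put no pebble on S,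
   P(v) - 1 pebbles on every other vertex v, and P(u) (t - 1) further pebbles
   on the vertex u labelled n.  The potential counting the pebbles on S plus,
   for every v outside S, the number floor(C(v) / P(v)) of moves available at v
   does not increase under pebbling moves.  It starts at t - 1, while covering
   S needs at least t, so this configuration, and every smaller one, is not
   t-solvable. *)
Require Import Defs.
From mathcomp Require Import all_boot.
From mathcomp Require Import boolp.

Set Implicit Arguments.
Unset Strict Implicit.
Unset Printing Implicit Defensive.

Lemma price_gt0 (G : sgraph) (P : price_function G) (v : G) : 0 < P v.
Proof. exact: ltnW (price_ge2 P v). Qed.

Section Potential.
Variables (G : sgraph) (P : price_function G) (S : {set G}).

Definition weight (v : G) (m : nat) : nat := if v \in S then m else m %/ P v.

Definition potential (C : config G) : nat := \sum_v weight v (C v).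

Lemma leq_weight v m m' : m <= m' -> weight v m <= weight v m'.
Proof. by rewrite /weight; case: ifP => // _ /leq_div2r. Qed.

Lemma weightS v m : weight v m.+1 <= (weight v m).+1.
Proof.
rewrite /weight; case: ifP => // _.
(* Outside [S], one new pebble is at most [P v] new pebbles, and those raise the quotient by exactly
   one. *)
apply: leq_trans (leq_div2r (P v) _) (_ : (m + P v) %/ P v <= _).
  by rewrite -addn1 leq_add2l price_gt0.
by rewrite divnDr // divnn price_gt0 addn1.
Qed.

Lemma weight_subP v m : P v <= m -> (weight v (m - P v)).+1 <= weight v m.
Proof.
rewrite /weight => le_m; case: ifP => _.
  by rewrite ltn_subrL price_gt0 (leq_trans _ le_m) ?price_gt0.
by rewrite -{2}(subnK le_m) divnDr // divnn price_gt0 addn1.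
Qed.

(** The loss at the source, at least one by [weight_subP], pays for the gain at the target, at most
    one by [weightS]. *)
Lemma potential_move C C' : pebbling_move P C C' -> potential C' <= potential C.
Proof.
move=> [x [y [exy le_P ->]]].
have neq_yx : y != x by apply: contraTneq exy => ->; rewrite edge_irrefl.
rewrite /potential !(bigD1 (P := predT) x) //=.
rewrite !(bigD1 (P := fun i => i != x) y) //=.
rewrite !ffunE !eqxx (negbTE neq_yx) eq_sym (negbTE neq_yx) addn0 subn0 addn1.
rewrite (eq_bigr (fun v => weight v (C v))) => [|v /andP[nvx nvy]]; last first.
  by rewrite ffunE (negbTE nvx) (negbTE nvy) subn0 addn0.
rewrite !addnA leq_add2r.
apply: leq_trans (leq_add (leqnn _) (weightS _ _)) _.
by rewrite addnS -addSn leq_add2r weight_subP.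
Qed.

Lemma potential_derivable C C' : derivable P C C' -> potential C' <= potential C.
Proof.
elim=> [{}C {}C' /potential_move //|//|C1 C2 C3 _ le12 _ le23].
exact: leq_trans le23 le12.
Qed.

Lemma covers_potential C : covers C S -> #|S| <= potential C.
Proof.
move=> covS; rewrite -sum1_card /potential big_mkcond; apply: leq_sum => v _.
by rewrite /weight; case: ifP => // /covS; rewrite -lt0n.
Qed.

Lemma leq_potential (C D : config G) :
  (forall v, C v <= D v) -> potential C <= potential D.
Proof. by move=> leCD; apply: leq_sum => v _; apply: leq_weight. Qed.

End Potential.

(** [all_solvable] speaks of exactly [k] pebbles, so refuting it for every [k] up to the size of a
    bad configuration takes a bad configuration of each such size. Pebbles are removed from [D] one
    at a time. *)
Lemma subconfig_exists (G : sgraph) (D : config G) k : k <= num_pebbles D ->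
  exists2 C : config G, num_pebbles C = k & forall v, C v <= D v.
Proof.
move=> le_k; have [m] := ubnP (num_pebbles D - k).
elim: m D le_k => // m IHm D; rewrite leq_eqVlt => /predU1P[-> _|lt_k lt_m].
  by exists D.
have [v Dv_gt0] : exists v, 0 < D v.
  apply/existsP; apply: contraTT lt_k => /existsPn D0.
  rewrite -leqNgt /num_pebbles big1 // => v _.
  by apply/eqP; rewrite -leqn0 leqNgt D0.
pose D' : config G := [ffun w => D w - (w == v)].
have numD : num_pebbles D = (num_pebbles D').+1.
  rewrite /num_pebbles (bigD1 v) //= [in RHS](bigD1 v) //= ffunE eqxx subn1.
  rewrite -addSn prednK //; congr addn; apply: eq_bigr => w /negbTE nwv.
  by rewrite ffunE nwv subn0.
rewrite numD in lt_k lt_m.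
have [||C numC leCD'] := IHm D'; first exact: lt_k.
  by rewrite -ltnS -subSn.
exists C => // w; apply: leq_trans (leCD' w) _.
by rewrite ffunE leq_subr.
Qed.

Lemma all_solvable_lower_bound (G : sgraph) (P : price_function G)
    (S : {set G}) (u : G) (k : nat) :
  u \notin S -> 0 < #|S| -> all_solvable P #|S| k ->
  \sum_(v | v \notin S) (P v - 1) + P u * (#|S| - 1) < k.
Proof.
move=> uS S_gt0 solv; rewrite ltnNge; apply/negP => le_k.
(* A multiple of [P u], so that the [P u - 1] pebbles already on [u] remain a remainder and the
   quotient at [u] is exactly [#|S| - 1]. *)
pose extra v := if v == u then P u * (#|S| - 1) else 0.
pose D : config G := [ffun v => if v \in S then 0 else P v - 1 + extra v].
have numD : num_pebbles D = \sum_(v | v \notin S) (P v - 1) + P u * (#|S| - 1).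
  transitivity (\sum_(v | v \notin S) (P v - 1 + extra v)).
    rewrite [RHS]big_mkcond; apply: eq_bigr => v _.
    by rewrite ffunE; case: (v \in S).
  rewrite big_split /=; congr addn.
  rewrite (bigD1 u) //= /extra eqxx big1 ?addn0 //.
  by move=> v /andP[_ /negbTE->].
have potD : potential P S D = #|S| - 1.
  rewrite /potential (bigD1 u) //= big1 => [|v /negbTE nvu].
    rewrite /weight ffunE (negbTE uS) /extra eqxx addn0 mulnC addnC.
    by rewrite divnMDl ?divn_small ?addn0 ?ltn_subrL ?price_gt0.
  rewrite /weight ffunE /extra nvu addn0; case: (v \in S) => //.
  by rewrite divn_small // ltn_subrL price_gt0.
(* The potential is monotone, so the bound for [D] passes to the subconfiguration [C] of size
   [k]. *)
rewrite -numD in le_k; have [C numC leCD] := subconfig_exists le_k.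
have [C' CC' covC'] := solv C numC S erefl.
have := leq_trans (covers_potential P covC') (potential_derivable S CC').
move=> /leq_trans/(_ (leq_potential P S leCD)).
(* Nonemptiness of [S] keeps the truncated [#|S| - 1] strictly below [#|S|]. *)
by rewrite potD leqNgt ltn_subrL S_gt0.
Qed.

Theorem theorem8 (G : sgraph) (conG : connected_graph G)
    (P : price_function G) (n : nat) (card_G : #|G| = n)
    (label : nat -> G)
    (label_enum : perm_eq [seq label i | i <- iota 1 n] (enum G))
    (label_sorted : forall i j : nat, 1 <= i -> i <= j -> j <= n ->
       P (label i) <= P (label j))
    (t : nat) (t_ge1 : 1 <= t) (t_ltn : t < n) :
  \sum_(t.+1 <= i < n.+1) (P (label i) - 1) + P (label n) * (t - 1) + 1
    <= pebbling_number conG P t.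
Proof.
rewrite /pebbling_number; case: ex_minnP => k /asboolP solv _.
have iota_cat : iota 1 n = iota 1 t ++ iota t.+1 (n - t).
  by rewrite -{1}(subnKC (ltnW t_ltn)) iotaD.
(* Distinctness of the labels gives both [#|S| = t] and that labels above [t] fall outside [S]. *)
have : uniq [seq label i | i <- iota 1 n].
  by rewrite (perm_uniq label_enum) enum_uniq.
rewrite iota_cat map_cat cat_uniq => /and3P[uniq_low /hasPn high_low _].
pose S := [set v in [seq label i | i <- iota 1 t]].
have cardS : #|S| = t by rewrite cardsE (card_uniqP uniq_low) size_map size_iota.
have highS i : t < i <= n -> label i \notin S.
  move=> /andP[lt_ti le_in]; rewrite inE; apply/high_low/map_f.
  by rewrite mem_iota lt_ti addSn ltnS subnKC // ltnW.
have := @all_solvable_lower_bound G P S (label n) k.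
rewrite cardS highS ?t_ltn ?leqnn // => /(_ isT t_ge1 solv).
have -> : \sum_(v | v \notin S) (P v - 1)
        = \sum_(t.+1 <= i < n.+1) (P (label i) - 1).
  transitivity (\sum_(v <- enum G | v \notin S) (P v - 1)).
    by rewrite big_enum_cond.
  (* Reindexed by labels, the sum splits at [t]; the low half is empty, since its vertices lie in
     [S]. *)
  rewrite -(perm_big _ label_enum) big_map iota_cat big_cat /=.
  rewrite big1_seq ?add0n => [|i /andP[lab_i i_low]]; last first.
    by rewrite inE map_f in lab_i.
  rewrite /index_iota subSS [LHS]big_seq_cond [RHS]big_seq; apply: eq_bigl => i.
  rewrite mem_iota addSn ltnS subnKC ?(ltnW t_ltn) //.
  by apply/andb_idr/highS.
by rewrite addn1.
Qed.
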